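(* Let $I\subseteq k[x_1,\dots,x_n]$ be a squarefree monomial ideal and $d\ge1$ an integer. Then $I$ has $d$-quotients if and only if the Alexander dual ideal $I^\ast$ is $d$-shellable (that is, the simplicial complex whose Stanley–Reisner ideal is $I^\ast$ is $d$-shellable).
   Context: $k$ is a field. Every squarefree monomial ideal $I$ is the Stanley–Reisner ideal of a unique simplicial complex $\Delta$ on $[n]$, i.e. $I=I_\Delta=(\prod_{i\in F}x_i:F\notin\Delta)$. The Alexander dual complex is $\Delta^\ast=\{F\subseteq[n]:[n]\setminus F\notin\Delta\}$, and $I^\ast=I_{\Delta^\ast}$. $\langle F_1,\dots,F_t\rangle$ denotes the simplicial complex generated by the sets $F_1,\dots,F_t$. A simplicial complex is $d$-shellable if its facets can be ordered $F_1,\dots,F_t$ such that for every $j=2,\dots,t$ the complex $\langle F_j\rangle\cap\langle F_1,\dots,F_{j-1}\rangle$ is generated by a non-empty set of proper faces of $\langle F_j\rangle$ all of dimension $|F_j|-d-1$ (dimension of a face is its cardinality minus one; the empty face has dimension $-1$). A monomial ideal $I$ has $d$-quotients if there is an ordering $u_1,\dots,u_t$ of its minimal monomial generators such that for every $s$ the colon ideal $(u_1,\dots,u_{s-1}):u_s$ is generated by monomials all of degree $d$ (for $s=1$ this is the zero ideal, with no generators). *)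

(* Defs.v *)
From Stdlib Require Import ClassicalEpsilon.
From HB Require Import structures.
From mathcomp Require Import all_boot all_order all_algebra.
From mathcomp.multinomials Require Import mpoly.

Set Implicit Arguments.
Unset Strict Implicit.
Unset Printing Implicit Defensive.

Import GRing.Theory.
Local Open Scope ring_scope.

Section Ideals.
Variable R : comNzRingType.

(* Ideals are represented by their membership predicates: [idealr] of
   mathcomp's ring_quotient only covers decidable ideals different from the
   whole ring, whereas the unit ideal is allowed here. *)
Definition same_ideal (I J : R -> Prop) : Prop := forall p, I p <-> J p.

Definition ideal_gen (S : R -> Prop) (p : R) : Prop :=
  exists (m : nat) (a g : 'I_m -> R),
    (forall i, S (g i)) /\ p = \sum_(i < m) a i * g i.

Definition colon (I : R -> Prop) (u p : R) : Prop := I (p * u).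

End Ideals.

Section MonomialIdeals.
Variables (k : fieldType) (n : nat).
Local Notation ideal := ({mpoly k[n]} -> Prop).

Definition monomial_ideal (M : 'X_{1..n} -> Prop) : ideal :=
  ideal_gen (fun p => exists2 m, M m & p = 'X_[m]).

Definition squarefree_monomial_ideal (I : ideal) : Prop :=
  exists2 M : 'X_{1..n} -> Prop,
    forall m, M m -> forall i, (m i <= 1)%N & same_ideal I (monomial_ideal M).

Definition minimal_monomial_generators (I : ideal) (u : seq 'X_{1..n}) : Prop :=
  [/\ uniq u,
      same_ideal I (monomial_ideal (fun m => m \in u)) &
      forall v : seq 'X_{1..n}, {subset v <= u} ->
        same_ideal I (monomial_ideal (fun m => m \in v)) -> {subset u <= v}].

(* With indices starting from 0, the [s]-th colon ideal is
   (u_0, ..., u_(s-1)) : u_s. *)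
Definition has_d_quotients (d : nat) (I : ideal) : Prop :=
  exists2 u : seq 'X_{1..n}, minimal_monomial_generators I u &
    forall s, (s < size u)%N ->
      exists2 M : 'X_{1..n} -> Prop, forall m, M m -> mdeg m = d &
        same_ideal
          (colon (monomial_ideal (fun m => m \in take s u)) 'X_[nth 0%MM u s])
          (monomial_ideal M).

End MonomialIdeals.

Section SimplicialComplexes.
Variable n : nat.
Implicit Types (F G : {set 'I_n}) (D : {set {set 'I_n}}).

(* The void complex [set0] (Stanley-Reisner ideal (1)) is allowed, and the
   singletons need not be faces. *)
Definition simplicial_complex D : Prop :=
  forall F G, G \in D -> F \subset G -> F \in D.

Definition complex_gen (A : {set {set 'I_n}}) : {set {set 'I_n}} :=
  [set G : {set 'I_n} | [exists F in A, G \subset F]].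

Definition facets D : {set {set 'I_n}} := [set F | maxset (mem D) F].

Definition face_dim F : int := #|F|%:Z - 1.

(* With indices starting from 0, the first facet carries no condition. *)
Definition d_shellable (d : nat) D : Prop :=
  exists s : seq {set 'I_n},
    [/\ uniq s, s =i facets D &
        forall j, (0 < j < size s)%N ->
          let Fj := nth set0 s j in
          exists A : {set {set 'I_n}},
            [/\ A != set0,
                forall G, G \in A ->
                  G \proper Fj /\ face_dim G = #|Fj|%:Z - d%:Z - 1 &
                complex_gen [set Fj] :&: complex_gen [set F in take j s]
                = complex_gen A]].

Definition alexander_dual D : {set {set 'I_n}} := [set F | ~: F \notin D].

End SimplicialComplexes.

Section StanleyReisner.
Variables (k : fieldType) (n : nat).
Local Notation ideal := ({mpoly k[n]} -> Prop).
Implicit Type D : {set {set 'I_n}}.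

Definition stanley_reisner D : ideal :=
  ideal_gen (fun p => exists2 F, F \notin D & p = \prod_(i in F) 'X_i).

(* The ideal I_(D^* ), where D is the complex with I = I_D; this complex is
   unique, see [alexander_dual_idealE] and [stanley_reisner_exists]. *)
Definition alexander_dual_ideal (I : ideal) : ideal := fun p =>
  exists D, [/\ simplicial_complex D, same_ideal I (stanley_reisner D)
              & stanley_reisner (alexander_dual D) p].

Definition d_shellable_ideal (d : nat) (I : ideal) : Prop :=
  exists D, [/\ simplicial_complex D, same_ideal I (stanley_reisner D)
              & d_shellable d D].

Definition set_mnm (F : {set 'I_n}) : 'X_{1..n} := [multinom (i \in F : nat) | i < n].

Lemma mpolyX_set_mnm (F : {set 'I_n}) :
  \prod_(i in F) 'X_i = 'X_[set_mnm F] :> {mpoly k[n]}.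
Proof.
rewrite mpolyXE_id big_mkcond; apply: eq_bigr => i _.
by rewrite mnmE; case: (i \in F); rewrite ?expr1 ?expr0.
Qed.

Lemma set_mnm_le (F G : {set 'I_n}) :
  (set_mnm F <= set_mnm G)%MM = (F \subset G).
Proof.
apply/mnm_lepP/subsetP => [le_FG i Fi | sFG i]; last first.
  by rewrite !mnmE; case Fi: (i \in F) => //; rewrite sFG.
by move: (le_FG i); rewrite !mnmE Fi; case: (i \in G).
Qed.

Lemma ideal_gen_mem (R : comNzRingType) (S : R -> Prop) p :
  S p -> ideal_gen S p.
Proof.
by move=> Sp; exists 1%N, (fun=> 1), (fun=> p); rewrite big_ord1 mul1r.
Qed.

Lemma ideal_gen_min (R : comNzRingType) (S T : R -> Prop) :
  (forall p, S p -> ideal_gen T p) -> forall p, ideal_gen S p -> ideal_gen T p.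
Proof.
move=> sST p [m [a [g [Sg ->]]]].
elim: m a g Sg => [|m IHm] a g Sg.
  by rewrite big_ord0; exists 0%N, (fun=> 0), (fun=> 0); split=> [[]|] //;
    rewrite big_ord0.
rewrite big_ord_recl.
have [m1 [a1 [g1 [Tg1 ->]]]] := sST _ (Sg ord0).
have [m2 [a2 [g2 [Tg2 ->]]]] :=
  IHm (fun i => a (lift ord0 i)) (fun i => g (lift ord0 i)) (fun i => Sg _).
pose b i := match split i with inl j => a ord0 * a1 j | inr j => a2 j end.
pose h i := match split i with inl j => g1 j | inr j => g2 j end.
exists (m1 + m2)%N, b, h; split=> [i|]; first by rewrite /h; case: (split i).
rewrite big_split_ord mulr_sumr /b /h; congr (_ + _); apply: eq_bigr => i _.
  by rewrite (unsplitK (inl _ i)) mulrA.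
by rewrite (unsplitK (inr _ i)).
Qed.

Lemma ideal_gen_mpolyX (M : 'X_{1..n} -> Prop) (S : {mpoly k[n]} -> Prop) m :
    (forall p, S p -> exists2 m', M m' & p = 'X_[m']) ->
  ideal_gen S 'X_[m] -> exists2 m', M m' & (m' <= m)%MM.
Proof.
move=> SM [l [a [g [Sg /(congr1 (mcoeff m))]]]].
rewrite mcoeffX eqxx raddf_sum /= => sum_neq0.
have /existsP[i ai]: [exists i, (a i * g i)@_m != 0].
  rewrite -negb_forall; apply/negP => /forallP a0.
  have /eqP := sum_neq0; rewrite big1 ?oner_eq0 // => i _.
  exact/eqP.
have [m' Mm' g_i] := SM _ (Sg i); exists m' => //.
move: ai; rewrite g_i -mcoeff_msupp (perm_mem (msuppMX _ _)).
by case/mapP => m2 _ ->; apply: lem_addr.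
Qed.

Lemma mem_stanley_reisner D (F : {set 'I_n}) :
  simplicial_complex D ->
  stanley_reisner D (\prod_(i in F) 'X_i) <-> F \notin D.
Proof.
move=> cD; split=> [|FD]; last by apply: ideal_gen_mem; exists F.
rewrite mpolyX_set_mnm => /(@ideal_gen_mpolyX
  (fun m => exists2 G, G \notin D & m = set_mnm G)) [_ [G GD ->]|_ [G GD ->]].
  by rewrite mpolyX_set_mnm; exists (set_mnm G) => //; exists G.
by rewrite set_mnm_le => sGF; apply: contra GD => /cD; apply.
Qed.

Lemma stanley_reisner_inj D D' :
  simplicial_complex D -> simplicial_complex D' ->
  same_ideal (stanley_reisner D) (stanley_reisner D') -> D = D'.
Proof.
move=> cD cD' eqDD'; apply/setP => F; apply: negb_inj.
by apply/idP/idP => /mem_stanley_reisner-/(_ _)/eqDD'/mem_stanley_reisner; auto.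
Qed.

Lemma alexander_dual_idealE D (I : ideal) :
  simplicial_complex D -> same_ideal I (stanley_reisner D) ->
  same_ideal (alexander_dual_ideal I) (stanley_reisner (alexander_dual D)).
Proof.
move=> cD ID p; split=> [[D' [cD' ID']]|]; last by exists D.
suff -> : D' = D by [].
by apply: stanley_reisner_inj => // q; rewrite -ID -ID'.
Qed.

Lemma stanley_reisner_exists (I : ideal) :
  squarefree_monomial_ideal I ->
  exists2 D, simplicial_complex D & same_ideal I (stanley_reisner D).
Proof.
case=> M sqfM IM.
pose nonface F := exists2 m, M m & (m <= set_mnm F)%MM.
pose D := [set F | ~~ (if excluded_middle_informative (nonface F)
                       then true else false)].
have DP F : F \notin D <-> nonface F.
  by rewrite inE; case: excluded_middle_informative.
exists D => [F G GD sFG|p].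
  apply: contraLR GD => /DP[m Mm le_mF]; apply/DP; exists m => //.
  by apply: lepm_trans le_mF _; rewrite set_mnm_le.
rewrite IM; split; apply: ideal_gen_min => {}p [].
  move=> m Mm ->; apply: ideal_gen_mem.
  pose F := [set i | m i == 1%N].
  have mF : m = set_mnm F.
    by apply/mnmP => i; rewrite mnmE inE; case: (m i) (sqfM m Mm i) => [|[]].
  exists F; last by rewrite mpolyX_set_mnm -mF.
  by apply/DP; exists m; rewrite // -mF lepm_refl.
move=> F /DP[m Mm le_mF] ->; rewrite mpolyX_set_mnm -(submK le_mF) mpolyXD.
by exists 1%N, (fun=> 'X_[set_mnm F - m]), (fun=> 'X_[m]);
  rewrite big_ord1; split=> // _; exists m.
Qed.

End StanleyReisner.

(* Main.v *)
Require Import Defs.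
From mathcomp Require Import all_boot all_algebra.
From mathcomp.multinomials Require Import mpoly.

(** Both properties are the same statement about the minimal nonfaces [U_j]
of the complex [D] with [I = I_D]: their monomials are the minimal generators
of [I], and their complements [F_j] are the facets of the Alexander dual.
The colon ideal [(u_1, ..., u_(j-1)) : u_j] is generated by the monomials of
the sets [U_i \ U_j = F_j \ F_i], and [<F_j>] meets [<F_1, ..., F_(j-1)>] in the
complex generated by the complements [F_i \cap F_j] of these sets in [F_j].
Generation in degree [d], respectively codimension [d], means that each
[U_i \ U_j] contains some [U_i' \ U_j] with exactly [d] elements. *)

Set Implicit Arguments.
Unset Strict Implicit.
Unset Printing Implicit Defensive.

Import GRing.Theory.
Local Open Scope ring_scope.

(** * Monomial ideals and their colon ideals, in terms of exponents *)

Section MonomialIdealMembership.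
Variables (k : fieldType) (n : nat).
Implicit Types (M N : 'X_{1..n} -> Prop) (p : {mpoly k[n]}) (m : 'X_{1..n}).

Definition dominated M m : Prop := exists2 m', M m' & (m' <= m)%MM.

(** A monomial of a sum of multiples of generators occurs in one summand, so that summand's
    generator divides it; conversely, [p] is the sum of its terms. *)
Lemma mem_monomial_ideal M p :
  monomial_ideal M p <-> forall m, m \in msupp p -> dominated M m.
Proof.
split=> [[l [a [g [Mg ->]]]] m|Mp].
  rewrite mcoeff_msupp raddf_sum /= => sum_neq0.
  have /existsP[i]: [exists i, (a i * g i)@_m != 0].
    rewrite -negb_forall; apply: contra sum_neq0 => /forallP a0.
    by rewrite big1 // => i _; apply/eqP.
  have [m' Mm' ->] := Mg i.
  rewrite -mcoeff_msupp (perm_mem (msuppMX _ _)) => /mapP[m2 _ ->].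
  by exists m' => //; apply: lem_addr.
have term_mem m : m \in msupp p -> monomial_ideal (k := k) M 'X_[m].
  case/Mp=> m' Mm' le_m'm; exists 1%N, (fun=> 'X_[m - m']), (fun=> 'X_[m']).
  by split=> [_|]; [exists m' | rewrite big_ord1 -mpolyXD submK].
rewrite [p]mpolyE.
apply: (@ideal_gen_min _ (fun q => exists2 m, m \in msupp p & q = 'X_[m])).
  by move=> _ [m m_p ->]; apply: term_mem.
exists (size (msupp p)), (fun i => (p@_(nth 0%MM (msupp p) i))%:MP),
  (fun i => 'X_[nth 0%MM (msupp p) i]).
split=> [i|]; first by exists (nth 0%MM (msupp p) i); rewrite ?mem_nth.
by rewrite (big_nth 0%MM) big_mkord; apply: eq_bigr => i _; rewrite mul_mpolyC.
Qed.

Lemma mem_monomial_idealX M m :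
  monomial_ideal (k := k) M 'X_[m] <-> dominated M m.
Proof.
split=> [/mem_monomial_ideal|Mm]; first by apply; rewrite msuppX inE.
by apply/mem_monomial_ideal => m'; rewrite msuppX inE => /eqP->.
Qed.

Lemma same_monomial_ideal M N :
  same_ideal (monomial_ideal (k := k) M) (monomial_ideal N) <->
  forall m, dominated M m <-> dominated N m.
Proof.
split=> [eqMN m|eqMN p].
  by split=> /mem_monomial_idealX/eqMN/mem_monomial_idealX.
by split=> /mem_monomial_ideal Hp; apply/mem_monomial_ideal => m /Hp/eqMN.
Qed.

(** Subtraction of exponents is truncated, so [a - u] is the exponent of [a] divided by its gcd with
    [u], and [a <= u + m] amounts to [a - u <= m]. *)
Lemma colon_monomial_ideal M u :
  same_ideal (colon (monomial_ideal (k := k) M) 'X_[u])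
             (monomial_ideal (fun m => exists2 a, M a & m = (a - u)%MM)).
Proof.
have dom m : dominated (fun m => exists2 a, M a & m = (a - u)%MM) m <->
             dominated M (u + m)%MM.
  split=> [[_ [a Ma ->] le_am]|[a Ma le_am]]; [exists a => // | exists (a - u)%MM].
  - apply/mnm_lepP => i; move/mnm_lepP/(_ i): le_am.
    by rewrite mnmBE mnmDE leq_subLR.
  - by exists a.
  - by apply/mnm_lepP => i; rewrite mnmBE leq_subLR -mnmDE; apply/mnm_lepP.
move=> p; rewrite /colon; split=> /mem_monomial_ideal Hp;
    apply/mem_monomial_ideal => m.
  (* The support of [p * 'X_[u]] is the support of [p] shifted by [u]. *)
  by move=> m_p; apply/dom/Hp; rewrite (perm_mem (msuppMX _ _)) map_f.
by rewrite (perm_mem (msuppMX _ _)) => /mapP[m' /Hp/dom ? ->].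
Qed.

(** This trades the unknown generators [M] for elements of [N]. Each [a] in [N] lies above some [m]
    in [M], which lies above some [b] in [N], which lies above some [m'] in [M]; as [m] and [m']
    both have degree [d], so has [b]. *)
Lemma generated_in_degree d N :
  (exists2 M, forall m, M m -> mdeg m = d &
     same_ideal (monomial_ideal (k := k) N) (monomial_ideal M)) <->
  forall a, N a -> exists2 b, N b & (b <= a)%MM /\ mdeg b = d.
Proof.
have mdeg_le (a b : 'X_{1..n}) : (a <= b)%MM -> (mdeg a <= mdeg b)%N.
  by move=> le_ab; rewrite -(submK le_ab) mdegD leq_addl.
split=> [[M degM /same_monomial_ideal eqNM] a Na|genN].
  have [m Mm le_ma]: dominated M a by apply/eqNM; exists a => //; apply: lepm_refl.
  have [b Nb le_bm]: dominated N m by apply/eqNM; exists m => //; apply: lepm_refl.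
  have [m' Mm' le_m'b]: dominated M b by apply/eqNM; exists b => //; apply: lepm_refl.
  exists b => //; split; first exact: lepm_trans le_ma.
  apply/eqP; rewrite eqn_leq -{1}(degM _ Mm) -(degM _ Mm').
  by rewrite !mdeg_le.
exists (fun m => N m /\ mdeg m = d) => [m []//|].
apply/same_monomial_ideal => m; split=> [[a /genN[b Nb [le_ba db]] le_am]|].
  by exists b => //; apply: lepm_trans le_am.
by case=> a [Na _] le_am; exists a.
Qed.

End MonomialIdealMembership.

(** * Squarefree monomials as sets of variables *)

Section SetMonomials.
Variable n : nat.
Implicit Types F G : {set 'I_n}.

Definition mnm_set (m : 'X_{1..n}) : {set 'I_n} := [set i | (0 < m i)%N].

Lemma set_mnmK : cancel (@set_mnm n) mnm_set.
Proof. by move=> F; apply/setP => i; rewrite inE mnmE lt0b. Qed.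

Lemma set_mnmB F G : (set_mnm F - set_mnm G)%MM = set_mnm (F :\: G).
Proof.
by apply/mnmP => i; rewrite mnmBE !mnmE inE; case: (i \in F); case: (i \in G).
Qed.

Lemma mdeg_set_mnm F : mdeg (set_mnm F) = #|F|.
Proof.
rewrite mdegE -sum1_card [RHS]big_mkcond /=.
by apply: eq_bigr => i _; rewrite mnmE; case: (i \in F).
Qed.

End SetMonomials.

(** * Minimal nonfaces and [d]-quotients *)

Section MinimalNonfaces.
Variables (k : fieldType) (n : nat).
Implicit Types (D : {set {set 'I_n}}) (F G U : {set 'I_n}) (P t : seq {set 'I_n}).

Definition min_nonfaces D : {set {set 'I_n}} :=
  [set F | minset (fun G => G \notin D) F].

Lemma stanley_reisner_monomial D :
  same_ideal (stanley_reisner (k := k) D)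
             (monomial_ideal (fun m => exists2 F, F \notin D & m = set_mnm F)).
Proof.
move=> p; split; apply: ideal_gen_min => {}p.
  case=> F FD ->; apply: ideal_gen_mem; exists (set_mnm F); first by exists F.
  exact: mpolyX_set_mnm.
case=> _ [F FD ->] ->; apply: ideal_gen_mem; exists F => //.
by rewrite mpolyX_set_mnm.
Qed.

Lemma minimal_generators_stanley_reisner D (I : {mpoly k[n]} -> Prop)
    (u : seq 'X_{1..n}) :
  same_ideal I (stanley_reisner D) ->
  minimal_monomial_generators I u <->
  uniq u /\ u =i [seq set_mnm F | F in min_nonfaces D].
Proof.
move=> ID.
(* Generating [I] becomes a condition on exponents alone, since every nonface contains a minimal
   one. *)
have genP (v : seq 'X_{1..n}) :
    same_ideal I (monomial_ideal (fun m => m \in v)) <->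
    forall m, dominated (fun m => m \in v) m <->
              exists2 F, F \in min_nonfaces D & (set_mnm F <= m)%MM.
  have nonfaceP m : dominated (fun m => exists2 F, F \notin D & m = set_mnm F) m
      <-> exists2 F, F \in min_nonfaces D & (set_mnm F <= m)%MM.
    split=> [[_ [F FD ->] le_Fm]|[F minF le_Fm]].
      have [G minG sGF] := minset_exists (P := fun G => G \notin D) FD.
      exists G; rewrite ?inE //; apply: lepm_trans le_Fm.
      by rewrite set_mnm_le.
    exists (set_mnm F) => //; exists F => //.
    by move: minF; rewrite inE => /minsetp.
  split=> [Iv m|domv p].
    rewrite -nonfaceP; move: m; apply/(same_monomial_ideal k) => p.
    by rewrite -Iv ID; apply: stanley_reisner_monomial.
  rewrite ID stanley_reisner_monomial; move: p.
  by apply/same_monomial_ideal => m; rewrite nonfaceP domv.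
have min_eq F G : F \in min_nonfaces D -> G \in min_nonfaces D ->
    F \subset G -> F = G.
  by rewrite !inE => /minsetp FD /minsetP[_ minG] sFG; apply: minG.
split=> [[uniq_u /genP domu minu]|[uniq_u def_u]].
  (* If [a] properly divided [b], deleting [b] from [u] would leave a generating sequence. *)
  have antichain a b : a \in u -> b \in u -> (a <= b)%MM -> a = b.
    move=> ua ub le_ab; apply/eqP/idPn => neq_ab.
    have: b \in [seq m <- u | m != b].
      apply: minu ub => [m|]; first by rewrite mem_filter => /andP[].
      apply/genP => m; rewrite -domu; split=> [[c]|[c uc le_cm]].
        by rewrite mem_filter => /andP[_ uc]; exists c.
      have [def_c|neq_cb] := eqVneq c b; last by exists c; rewrite // mem_filter neq_cb.
      exists a; first by rewrite mem_filter neq_ab.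
      by apply: lepm_trans le_ab _; rewrite -def_c.
    by rewrite mem_filter eqxx.
  (* Some [a] in [u] divides the monomial of [F], and the monomial of some minimal nonface [G]
     divides [a]. Then [G = F], which squeezes [a]. *)
  have min_in_u F : F \in min_nonfaces D -> set_mnm F \in u.
    move=> minF; have [|a ua le_aF] := (domu (set_mnm F)).2.
      by exists F; rewrite ?lepm_refl.
    have [|G minG le_Ga] := (domu a).1; first by exists a; rewrite ?lepm_refl.
    have eqGF : G = F.
      by apply: min_eq => //; rewrite -set_mnm_le; apply: lepm_trans le_aF.
    suff <- : a = set_mnm F by [].
    apply/mnmP => i; apply/eqP; rewrite eqn_leq (mnm_lepP le_aF).
    by rewrite -eqGF (mnm_lepP le_Ga).
  split=> // m; apply/idP/imageP => [um|[F minF ->]]; last exact: min_in_u.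
  have [|F minF le_Fm] := (domu m).1; first by exists m; rewrite ?lepm_refl.
  by exists F => //; rewrite -(antichain (set_mnm F) m) ?min_in_u.
split=> //.
  apply/genP => m; split=> [[a]|[F minF le_Fm]].
    by rewrite def_u => /imageP[F minF ->]; exists F.
  by exists (set_mnm F) => //; rewrite def_u; apply/imageP; exists F.
move=> v sub_vu /genP domv a; rewrite def_u => /imageP[F minF ->].
have [|c vc le_cF] := (domv (set_mnm F)).2; first by exists F; rewrite ?lepm_refl.
have /imageP[G minG def_c] : c \in [seq set_mnm F | F in min_nonfaces D].
  by rewrite -def_u sub_vu.
move: vc le_cF; rewrite def_c set_mnm_le => vG sGF.
by rewrite -(min_eq _ _ minG minF sGF).
Qed.

(** The condition to which both sides are reduced, with [P] the predecessors of [U]. It is vacuous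
    for empty [P], in accordance with the zero colon ideal and the unconstrained first facet. *)
Definition quotient_step d P U : Prop :=
  forall V, V \in P ->
    exists2 W, W \in P & W :\: U \subset V :\: U /\ #|W :\: U| = d.

Lemma colon_generated_in_degree d P U :
  (exists2 M : 'X_{1..n} -> Prop, forall m, M m -> mdeg m = d &
     same_ideal (colon (monomial_ideal (k := k)
                          (fun m => m \in [seq set_mnm F | F <- P]))
                       'X_[set_mnm U])
                (monomial_ideal M)) <->
  quotient_step d P U.
Proof.
set N := fun m => exists2 a, a \in [seq set_mnm F | F <- P] &
                             m = (a - set_mnm U)%MM.
have colonN : same_ideal (colon (monomial_ideal (k := k)
     (fun m => m \in [seq set_mnm F | F <- P])) 'X_[set_mnm U])
     (monomial_ideal N) by apply: colon_monomial_ideal.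
have NP m : N m <-> exists2 V, V \in P & m = set_mnm (V :\: U).
  split=> [[_ /mapP[V PV ->] ->]|[V PV ->]]; first by exists V; rewrite ?set_mnmB.
  by exists (set_mnm V); rewrite ?set_mnmB ?map_f.
apply: (iff_trans (B := exists2 M : 'X_{1..n} -> Prop,
    forall m, M m -> mdeg m = d &
    same_ideal (monomial_ideal (k := k) N) (monomial_ideal M))).
  by split=> -[M degM eqM]; exists M => // p; rewrite -eqM; have := colonN p; tauto.
rewrite generated_in_degree; split=> [genN V PV|stepP _ /NP[V PV ->]].
  have /genN[_ /NP[W PW ->]] : N (set_mnm (V :\: U)) by apply/NP; exists V.
  by rewrite set_mnm_le mdeg_set_mnm; exists W.
have [W PW [sWV dW]] := stepP V PV.
exists (set_mnm (W :\: U)); first by apply/NP; exists W.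
by rewrite set_mnm_le mdeg_set_mnm.
Qed.

Lemma has_d_quotientsP d D (I : {mpoly k[n]} -> Prop) :
  same_ideal I (stanley_reisner D) ->
  has_d_quotients d I <->
  exists t, [/\ uniq t, t =i min_nonfaces D &
    forall j, (j < size t)%N -> quotient_step d (take j t) (nth set0 t j)].
Proof.
move=> ID; have minP u := minimal_generators_stanley_reisner u ID.
have inj := can_inj (@set_mnmK n).
split=> [[u /minP[uniq_u def_u] quot_u]|[t [uniq_t def_t step_t]]].
  (* All entries of [u] are squarefree, so [u] is recovered from their supports. *)
  have [t def_ut] : exists t, u = [seq set_mnm F | F <- t].
    exists [seq mnm_set m | m <- u]; rewrite -map_comp map_id_in // => m.
    by rewrite def_u => /imageP[F _ ->] /=; rewrite set_mnmK.
  subst u; exists t; split=> [|F|j ltjt].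
  - by rewrite (map_inj_uniq inj) in uniq_u.
  - by rewrite -(mem_map inj) def_u mem_image.
  - have := quot_u j; rewrite size_map (nth_map set0) // -map_take.
    by move=> /(_ ltjt)/colon_generated_in_degree.
exists [seq set_mnm F | F <- t].
  apply/minP; split=> [|m]; first by rewrite (map_inj_uniq inj).
  apply/mapP/imageP => -[F]; first by rewrite def_t; exists F.
  by rewrite -def_t; exists F.
move=> j; rewrite size_map => ltjt; rewrite (nth_map set0) // -map_take.
exact/colon_generated_in_degree/step_t.
Qed.

End MinimalNonfaces.

(** * Facets of the Alexander dual and shellings *)

Section AlexanderDual.
Variable n : nat.
Implicit Types (D : {set {set 'I_n}}) (F G U : {set 'I_n}) (P t : seq {set 'I_n}).

Lemma alexander_dual_complex D :
  simplicial_complex D -> simplicial_complex (alexander_dual D).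
Proof.
move=> cD F G; rewrite !inE => GD sFG; apply: contra GD => /cD; apply.
by rewrite setCS.
Qed.

(** Complementation reverses inclusion and exchanges faces of the dual with nonfaces of [D], so
    maximal becomes minimal. *)
Lemma facets_alexander_dual D F :
  (F \in facets (alexander_dual D)) = (~: F \in min_nonfaces D).
Proof.
rewrite !inE; apply/maxsetP/minsetP => -[/=]; rewrite ?inE => FD maxF;
    split=> //= G.
- by move=> GD sGF; apply: setC_inj; rewrite setCK; apply: maxF;
    rewrite ?inE ?setCK // -setCS setCK.
- by rewrite inE => GD sFG; apply/setC_inj/maxF; rewrite ?setCS.
Qed.

(* [1 <= d] makes the generators proper faces, and [P != [::]] makes the set of
   generators non-empty. *)
Lemma shelling_step d P U : (1 <= d)%N -> P != [::] ->
  (exists A : {set {set 'I_n}},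
     [/\ A != set0,
         forall G, G \in A ->
           G \proper ~: U /\ face_dim G = #|~: U|%:Z - d%:Z - 1 &
         complex_gen [set ~: U] :&: complex_gen [set F in [seq ~: V | V <- P]]
         = complex_gen A]) <->
  quotient_step d P U.
Proof.
move=> d_gt0 P_neq0.
(* The codimension of [~: U :&: ~: V] in [~: U] is the size of [V :\: U]. *)
have cardP V : (#|~: U| = #|~: U :&: ~: V| + #|V :\: U|)%N.
  by rewrite -(cardsID (~: V) (~: U)) setDE setCK setDE [V :&: _]setIC.
have subP V W : (~: U :&: ~: V \subset ~: U :&: ~: W) = (W :\: U \subset V :\: U).
  rewrite -!setCU setCS subUset subsetUl /= subDset.
  by rewrite setDE setUIr setUCr setIT.
have dimP G : (face_dim G = #|~: U|%:Z - d%:Z - 1) <-> (#|~: U| = #|G| + d)%N.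
  rewrite /face_dim; split=> [/addIr/eqP|->]; last by rewrite PoszD addrK.
  by rewrite eq_sym subr_eq -PoszD => /eqP[].
have interP G :
    (G \in complex_gen [set ~: U] :&: complex_gen [set F in [seq ~: V | V <- P]])
    <-> exists2 V, V \in P & G \subset ~: U :&: ~: V.
  rewrite !inE; split=> [/andP[/existsP[F /andP[]]]|[V PV]].
    rewrite inE => /eqP-> sGU /existsP[H /andP[]].
    by rewrite inE => /mapP[V PV ->] sGV; exists V; rewrite // subsetI sGU.
  rewrite subsetI => /andP[sGU sGV]; apply/andP; split; apply/existsP.
    by exists (~: U); rewrite inE eqxx.
  by exists (~: V); rewrite inE map_f.
split=> [[A [_ dimA defA]] V PV|stepP].
  (* The intersection for [V] lies in a generator [G], which lies in the intersection for some [W],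
     which lies in a generator [H]. As [G] and [H] have equal size, the intersection for [W] has
     codimension exactly [d]. *)
  have: ~: U :&: ~: V \in complex_gen A.
    by rewrite -defA; apply/interP; exists V.
  rewrite inE => /existsP[G /andP[AG sVG]].
  have: G \in complex_gen A by rewrite inE; apply/existsP; exists G; rewrite AG /=.
  rewrite -defA => /interP[W PW sGW].
  have: ~: U :&: ~: W \in complex_gen A.
    by rewrite -defA; apply/interP; exists W.
  rewrite inE => /existsP[H /andP[AH sWH]].
  exists W => //; split; first by rewrite -subP; apply: subset_trans sGW.
  have [_ /dimP dimG] := dimA G AG; have [_ /dimP dimH] := dimA H AH.
  have eq_card : #|~: U :&: ~: W| = #|G|.
    apply/eqP; rewrite eqn_leq (subset_leq_card sGW) andbT.
    by rewrite -(leq_add2r d) -dimG dimH leq_add2r subset_leq_card.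
  by apply/eqP; rewrite -(eqn_add2l #|G|) -dimG -eq_card -cardP.
(* The generators are the intersections of codimension exactly [d]; by [stepP] every other
   intersection lies in one of them. *)
exists [set ~: U :&: ~: V | V in [set V in P | #|V :\: U| == d]]; split.
- case: P P_neq0 stepP {interP} => // V P _ stepP.
  have [|W PW [_ dW]] := stepP V; first exact: mem_head.
  apply/set0Pn; exists (~: U :&: ~: W); apply/imsetP.
  by exists W; rewrite // inE PW dW /=.
- move=> G /imsetP[V]; rewrite inE => /andP[_ /eqP dV] ->.
  split; last by apply/dimP; rewrite -dV -cardP.
  by rewrite properEcard subsetIl [X in (_ < X)%N](cardP V) dV -addn1 leq_add2l.
- apply/setP => G; apply/idP/idP => [/interP[V PV sGV]|].
    have [W PW [sWV dW]] := stepP V PV.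
    rewrite inE; apply/existsP; exists (~: U :&: ~: W).
    apply/andP; split; last by apply: subset_trans sGV _; rewrite subP.
    by apply/imsetP; exists W; rewrite // inE PW dW /=.
  rewrite inE => /existsP[H /andP[/imsetP[V]]].
  by rewrite inE => /andP[PV _] -> sGV; apply/interP; exists V.
Qed.

Lemma d_shellable_alexander_dual d D : (1 <= d)%N ->
  d_shellable d (alexander_dual D) <->
  exists t, [/\ uniq t, t =i min_nonfaces D &
    forall j, (j < size t)%N -> quotient_step d (take j t) (nth set0 t j)].
Proof.
move=> d_gt0; have inj := can_inj (@setCK 'I_n).
have stepsP t :
    (forall j, (j < size t)%N -> quotient_step d (take j t) (nth set0 t j)) <->
    (forall j, (0 < j < size [seq ~: V | V <- t])%N ->
       let Fj := nth set0 [seq ~: V | V <- t] j in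
       exists A : {set {set 'I_n}},
         [/\ A != set0,
             forall G, G \in A ->
               G \proper Fj /\ face_dim G = #|Fj|%:Z - d%:Z - 1 &
             complex_gen [set Fj] :&:
               complex_gen [set F in take j [seq ~: V | V <- t]]
             = complex_gen A]).
  rewrite size_map; split=> stept j.
    case/andP=> j_gt0 ltjt; rewrite /= (nth_map set0) // -map_take.
    apply/shelling_step => //; last exact: stept.
    by rewrite -size_eq0 size_take ltjt -lt0n.
  (* A shelling says nothing at index 0, where the prefix is empty and the quotient step is
     vacuous. *)
  case: j => [|j] ltjt; first by rewrite take0 => V.
  have := stept j.+1 ltjt; rewrite /= (nth_map set0) // -map_take.
  by move/shelling_step; apply; rewrite // -size_eq0 size_take ltjt.
split=> [[s [uniq_s def_s steps]]|[t [uniq_t def_t stept]]].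
  have def_st : s = [seq ~: V | V <- [seq ~: F | F <- s]].
    by rewrite -map_comp map_id_in // => F _ /=; rewrite setCK.
  exists [seq ~: F | F <- s]; split; first by rewrite (map_inj_uniq inj).
    move=> F; rewrite -{1}[F]setCK (mem_map inj) def_s facets_alexander_dual.
    by rewrite setCK.
  by apply/stepsP; rewrite -def_st.
exists [seq ~: V | V <- t]; split; first by rewrite (map_inj_uniq inj).
  by move=> F; rewrite facets_alexander_dual -def_t -{1}[F]setCK (mem_map inj).
exact/stepsP.
Qed.

End AlexanderDual.

Theorem theorem6p8 (k : fieldType) (n d : nat) (I : {mpoly k[n]} -> Prop)
    (d_ge1 : (1 <= d)%N) (I_sqfree : squarefree_monomial_ideal I) :
  has_d_quotients d I <-> d_shellable_ideal d (alexander_dual_ideal I).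
Proof.
have [D cD ID] := stanley_reisner_exists I_sqfree.
have cD' := alexander_dual_complex cD.
have ID' := alexander_dual_idealE cD ID.
rewrite (has_d_quotientsP d ID) -(d_shellable_alexander_dual D d_ge1).
split=> [shell|[D1 [cD1 ID1 shell]]]; first by exists (alexander_dual D).
(* The shellable complex [D1] is only known through its ideal, which determines it. *)
suff -> : alexander_dual D = D1 by [].
by apply: (@stanley_reisner_inj k) => // p; rewrite -ID' -ID1.
Qed.
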